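(* Let $A$ be an affine cellular $k$-algebra with cell chain $0=J_0\subset J_1\subset\cdots\subset J_n=A$ and cell data $(B_i,\sigma_i,\Delta_i,\psi^{(i)},\alpha_i)$, $1\le i\le n$. For any $1\le i\le n$ the following hold. (1) If $J_i/J_{i-1}$ is idempotent (as an ideal of $A/J_{i-1}$), then (a) $\mathrm{Hom}_A(\Delta_i,\Delta_j)=0$ for all $j>i$; (b) every non-zero $A$-endomorphism of $\Delta_i$ is injective if and only if $B_i$ is an integral domain. (2) $\mathrm{Hom}_A(\Delta_j,\Delta_i)=0$ for all $j>i$ if and only if $\det(\psi^{(i)})$ is not a zero-divisor in $B_i$.
   Context: Conventions. $k$ is a commutative Noetherian domain. A $k$-involution is a $k$-linear anti-automorphism whose square is the identity. An affine commutative $k$-algebra is a finitely generated commutative unital $k$-algebra. The element $0$ counts as a zero-divisor. An ideal $J$ is idempotent if $J^2=J$. Affine cell ideal. Let $A$ be a unital $k$-algebra with a $k$-involution $i$. A two-sided ideal $J$ with $i(J)=J$ is an affine cell ideal if (1) there are a free $k$-module $V$ of finite rank $d\ge1$ and a nonzero affine commutative $k$-algebra $B$ with $k$-involution $\sigma$ such that $\Delta:=V\otimes_kB$ is an $A$-$B$-bimodule whose right $B$-structure is induced by the regular module $B_B$; (2) there is an $A$-$A$-bimodule isomorphism $\alpha:J\to\Delta\otimes_B\Delta'$, where $\Delta'=B\otimes_kV$ is a $B$-$A$-bimodule with left $B$-structure induced by ${}_BB$ and right $A$-structure $(b\otimes v)a:=\tau(i(a)(v\otimes b))$, $\tau$ the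 flip, such that, identifying $\Delta\otimes_B\Delta'$ with $V\otimes_kB\otimes_kV$, $\alpha(i(\alpha^{-1}(u\otimes b\otimes v)))=v\otimes\sigma(b)\otimes u$. $\Delta$ is the cell module of $J$. There is a $k$-bilinear $\psi:V\times V\to B$ with $\alpha(\alpha^{-1}(u\otimes b\otimes v)\,\alpha^{-1}(u'\otimes b'\otimes v'))=u\otimes b\psi(v,u')b'\otimes v'$. Fix a basis $v_1,\dots,v_d$ of $V$; the swich matrix is $\psi=(\psi(v_r,v_s))_{r,s}\in M_d(B)$. Identifying $v_r\otimes b\otimes v_s$ with $bE_{rs}$, $\alpha$ becomes a bijection $J\to M_d(B)$ with $\alpha(xy)=\alpha(x)\psi\alpha(y)$. $(B,\sigma,\Delta,\psi,\alpha)$ is the cell datum of $J$. Affine cellular algebra. $A$ (with $i$) is affine cellular if $A=J_1'\oplus\cdots\oplus J_n'$ as $k$-modules with $i(J_j')=J_j'$, such that the $J_j=\bigoplus_{l\le j}J_l'$ form a chain of two-sided ideals $0=J_0\subset J_1\subset\cdots\subset J_n=A$ (cell chain) and each $J_j/J_{j-1}$ is an affine cell ideal of $A/J_{j-1}$ (for the induced involution), with cell datum $(B_j,\sigma_j,\Delta_j,\psi^{(j)},\alpha_j)$. The cell modules $\Delta_j$ are viewed as left $A$-modules. *)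

(* Defs.v *)
From HB Require Import structures.
From mathcomp Require Import all_boot all_order all_algebra.
From mathcomp Require Import boolp.
Set Implicit Arguments.
Unset Strict Implicit.
Unset Printing Implicit Defensive.
Import GRing.Theory.
Local Open Scope ring_scope.
Local Open Scope quotient_scope.

Section Ideals.
Variable R : nzRingType.

Definition ideal_closed (S : {pred R}) : Prop :=
  [/\ zmod_closed S, forall a x, x \in S -> a * x \in S
    & forall a x, x \in S -> x * a \in S].

Definition ideal_square (S : {pred R}) : {pred R} :=
  [pred z | `[< exists s : seq (R * R),
    (forall p, p \in s -> p.1 \in S /\ p.2 \in S) /\
    z = \sum_(p <- s) p.1 * p.2 >]].

Definition idempotent_ideal (S : {pred R}) : Prop := ideal_square S =i S.

(* Note that 0 is a zero-divisor, since R is nontrivial. *)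
Definition zero_divisor (x : R) : Prop := exists2 y, y != 0 & x * y = 0.

End Ideals.

Definition noetherian (k : comNzRingType) : Prop :=
  forall I : {pred k}, ideal_closed I ->
    exists s : seq k, forall x,
      x \in I <-> exists c : 'I_(size s) -> k, x = \sum_t c t * s`_t.

Section Algebras.
Variable k : idomainType.

Definition k_involution (A : algType k) (i : A -> A) : Prop :=
  [/\ linear i, forall x y, i (x * y) = i y * i x & involutive i].

Definition finitely_generated (B : comAlgType k) : Prop :=
  exists s : seq B, forall S : {pred B},
    subalg_closed S -> {subset s <= S} -> forall b, b \in S.

End Algebras.

(* ring_quotient provides the quotient of a zmodType by any subgroup, but a    *)
(* ring structure on it only in the commutative case.  Ideals are taken proper *)
(* here because MathComp algebras are nontrivial.                              *)
Record twosided_ideal (k : idomainType) (A : algType k) := TwosidedIdeal {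
  pideal_pred :> {pred A};
  pideal_closed : ideal_closed pideal_pred;
  pideal_proper : 1 \notin pideal_pred }.

Section Quotient.
Variables (k : idomainType) (A : algType k) (J : twosided_ideal A).

Let J_zmod : zmod_closed (pideal_pred J).
Proof. by case: (pideal_closed J). Qed.

HB.instance Definition _ := GRing.isZmodClosed.Build A (pideal_pred J) J_zmod.

Local Notation zquot := (Quotient.quot (pideal_pred J : zmodClosed A)).
Definition alg_quot : Type := zquot.
HB.instance Definition _ := GRing.Zmodule.on alg_quot.

Definition quot_proj (x : A) : alg_quot := \pi_zquot x.
Definition quot_repr (q : alg_quot) : A := repr (q : zquot).

Lemma quot_projP x y : reflect (quot_proj x = quot_proj y) (x - y \in J).
Proof. by rewrite [_ \in _]Quotient.idealrBE; exact: eqP. Qed.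

Lemma quot_proj_repr (q : alg_quot) : quot_proj (quot_repr q) = q.
Proof. exact: reprK. Qed.

Lemma quot_projD x y : quot_proj (x + y) = quot_proj x + quot_proj y.
Proof. exact: (raddfD \pi_zquot). Qed.

Lemma quot_projB x y : quot_proj (x - y) = quot_proj x - quot_proj y.
Proof. by apply: (addIr (quot_proj y)); rewrite -quot_projD !subrK. Qed.

Lemma quot_ind (P : alg_quot -> Prop) :
  (forall x, P (quot_proj x)) -> forall q, P q.
Proof. by move=> H q; rewrite -[q]quot_proj_repr. Qed.

Let idl a x : x \in J -> a * x \in J.
Proof. by case: (pideal_closed J) => _ h _; exact: h. Qed.
Let idr a x : x \in J -> x * a \in J.
Proof. by case: (pideal_closed J) => _ _; apply. Qed.
Let idD x y : x \in J -> y \in J -> x + y \in J.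
Proof. exact: (@rpredD _ (pideal_pred J : zmodClosed A)). Qed.
Let repr_sub x : x - quot_repr (quot_proj x) \in J.
Proof. by apply/quot_projP; rewrite quot_proj_repr. Qed.

Definition quot_one : alg_quot := quot_proj 1.
Definition quot_mul (p q : alg_quot) : alg_quot := quot_proj (quot_repr p * quot_repr q).
Definition quot_scale (c : k) (q : alg_quot) : alg_quot :=
  quot_proj (c *: quot_repr q).

Lemma quot_projM x y : quot_proj (x * y) = quot_mul (quot_proj x) (quot_proj y).
Proof.
apply/quot_projP.
set x' := quot_repr _; set y' := quot_repr _.
have -> : x * y - x' * y' = (x - x') * y + x' * (y - y').
  by rewrite mulrBl mulrBr addrA subrK.
by apply: idD; [apply: idr | apply: idl]; exact: repr_sub.
Qed.

Lemma quot_projZ c x : quot_proj (c *: x) = quot_scale c (quot_proj x).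
Proof.
apply/quot_projP; rewrite -scalerBr -mulr_algl.
by apply: idl; exact: repr_sub.
Qed.

Let mulA : associative quot_mul.
Proof.
by elim/quot_ind=> x; elim/quot_ind=> y; elim/quot_ind=> z; rewrite -!quot_projM mulrA.
Qed.
Let mul1 : left_id quot_one quot_mul.
Proof. by elim/quot_ind=> x; rewrite -quot_projM mul1r. Qed.
Let mulr1_ : right_id quot_one quot_mul.
Proof. by elim/quot_ind=> x; rewrite -quot_projM mulr1. Qed.
Let mulDl : left_distributive quot_mul +%R.
Proof.
elim/quot_ind=> x; elim/quot_ind=> y; elim/quot_ind=> z.
by rewrite -quot_projD -!quot_projM mulrDl quot_projD.
Qed.
Let mulDr : right_distributive quot_mul +%R.
Proof.
elim/quot_ind=> x; elim/quot_ind=> y; elim/quot_ind=> z.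
by rewrite -quot_projD -!quot_projM mulrDr quot_projD.
Qed.
Let one_neq0 : quot_one != 0.
Proof.
apply/eqP=> h.
have /quot_projP : quot_proj 1 = quot_proj 0.
  by rewrite -[RHS](addrK (quot_proj 0)) -quot_projD addr0 subrr.
by rewrite subr0; apply/negP; exact: pideal_proper.
Qed.

HB.instance Definition _ := GRing.Zmodule_isNzRing.Build alg_quot
  mulA mul1 mulr1_ mulDl mulDr one_neq0.

Let scaleA a b q : quot_scale a (quot_scale b q) = quot_scale (a * b) q.
Proof. by elim/quot_ind: q => x; rewrite -!quot_projZ scalerA. Qed.
Let scale1 : left_id 1 quot_scale.
Proof. by elim/quot_ind=> x; rewrite -quot_projZ scale1r. Qed.
Let scaleDr : right_distributive quot_scale +%R.
Proof.
by move=> a; elim/quot_ind=> x; elim/quot_ind=> y;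
  rewrite -quot_projD -!quot_projZ scalerDr quot_projD.
Qed.
Let scaleDl q : {morph quot_scale^~ q : a b / a + b}.
Proof.
by move=> a b; elim/quot_ind: q => x; rewrite -!quot_projZ scalerDl quot_projD.
Qed.

HB.instance Definition _ := GRing.Zmodule_isLmodule.Build k alg_quot
  scaleA scale1 scaleDr scaleDl.

Let scaleAl (a : k) (p q : alg_quot) : a *: (p * q) = (a *: p) * q.
Proof.
elim/quot_ind: p => x; elim/quot_ind: q => y.
by rewrite -[_ * _]quot_projM -[LHS]quot_projZ -[a *: _]quot_projZ
  -[RHS]quot_projM scalerAl.
Qed.
HB.instance Definition _ := GRing.Lmodule_isLalgebra.Build k alg_quot scaleAl.

Let scaleAr (a : k) (p q : alg_quot) : a *: (p * q) = p * (a *: q).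
Proof.
elim/quot_ind: p => x; elim/quot_ind: q => y.
by rewrite -[_ * _]quot_projM -[LHS]quot_projZ -[a *: _]quot_projZ
  -[RHS]quot_projM scalerAr.
Qed.
HB.instance Definition _ := GRing.Lalgebra_isAlgebra.Build k alg_quot scaleAr.

HB.instance Definition _ := GRing.isZmodMorphism.Build A alg_quot quot_proj quot_projB.
Let quot_proj_monoid : monoid_morphism quot_proj.
Proof. by split=> // x y; exact: quot_projM. Qed.
HB.instance Definition _ :=
  GRing.isMonoidMorphism.Build A alg_quot quot_proj quot_proj_monoid.
HB.instance Definition _ :=
  GRing.isScalable.Build k A alg_quot *:%R quot_proj quot_projZ.

Definition quot_invol (i : A -> A) (q : alg_quot) : alg_quot :=
  quot_proj (i (quot_repr q)).

Lemma quot_involE (i : A -> A) : k_involution i ->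
  (forall x, x \in J -> i x \in J) ->
  forall x, quot_invol i (quot_proj x) = quot_proj (i x).
Proof.
case=> il _ _ iJ x; apply/quot_projP.
have iB y z : i (y - z) = i y - i z.
  by rewrite addrC -scaleN1r il scaleN1r addrC.
by rewrite -iB; apply/iJ; rewrite -[_ - _]opprB (@rpredN _ (pideal_pred J : zmodClosed A)).
Qed.

Definition quot_ideal (I : {pred A}) : {pred alg_quot} :=
  [pred q | `[< exists2 x, x \in I & q = quot_proj x >]].

End Quotient.

Arguments quot_proj {k A} J x.
Arguments quot_invol {k A} J i q.
Arguments quot_ideal {k A} J I _.

Definition restrict_scalars (R S : nzRingType) (f : {rmorphism R -> S})
  (M : lmodType S) : Type := M.

Section Restriction.
Variables (R S : nzRingType) (f : {rmorphism R -> S}) (M : lmodType S).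

HB.instance Definition _ := GRing.Zmodule.on (restrict_scalars f M).

Definition res_scale (a : R) (x : restrict_scalars f M) : restrict_scalars f M := f a *: (x : M).

Let scaleA a b x : res_scale a (res_scale b x) = res_scale (a * b) x.
Proof. by rewrite /res_scale scalerA rmorphM. Qed.
Let scale1 : left_id 1 res_scale.
Proof. by move=> x; rewrite /res_scale rmorph1 scale1r. Qed.
Let scaleDr : right_distributive res_scale +%R.
Proof. by move=> a x y; rewrite /res_scale scalerDr. Qed.
Let scaleDl x : {morph res_scale^~ x : a b / a + b}.
Proof. by move=> a b; rewrite /res_scale rmorphD scalerDl. Qed.
HB.instance Definition _ := GRing.Zmodule_isLmodule.Build R (restrict_scalars f M)
  scaleA scale1 scaleDr scaleDl.

End Restriction.

(* V is k^d with the standard basis.  Then V (x) B is 'cV[B]_d,                *)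
(* B (x) V is 'rV[B]_d and V (x) B (x) V is 'M[B]_d, where v_r (x) b (x) v_s   *)
(* is b E_rs.  Since B is commutative, both the right and the left regular     *)
(* B-structures are the scaling *:.                                            *)
Section CellTensors.
Variables (k : idomainType) (A : algType k) (i : A -> A).
Variables (B : comAlgType k) (d : nat).

Definition pure_tensor (u : 'cV[k]_d) (b : B) (v : 'cV[k]_d) : 'M[B]_d :=
  \matrix_(r, s) ((u r 0 * v s 0) *: b).

Variable act : A -> 'cV[B]_d -> 'cV[B]_d.

Record bimodule_action : Prop := {
  act1 : forall x, act 1 x = x;
  actM : forall a b x, act (a * b) x = act a (act b x);
  actDl : forall a b x, act (a + b) x = act a x + act b x;
  actDr : forall a x y, act a (x + y) = act a x + act a y;
  actB : forall a (b : B) x, act a (b *: x) = b *: act a x;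
  actk : forall (c : k) a x, act (c *: a) x = c%:A *: act a x }.

(* The right A-structure on Delta' = B (x) V; the flip is transposition. *)
Definition dual_act (y : 'rV[B]_d) (a : A) : 'rV[B]_d := (act (i a) y^T)^T.

(* Delta (x)_B Delta' is identified with 'M[B]_d through x (x) y |-> x *m y;   *)
(* the two A-structures then act column by column and row by row, see          *)
(* tensor_lactE and tensor_ractE.                                              *)
Definition tensor_lact (a : A) (M : 'M[B]_d) : 'M[B]_d :=
  \matrix_(r, s) act a (col s M) r 0.
Definition tensor_ract (M : 'M[B]_d) (a : A) : 'M[B]_d :=
  \matrix_(r, s) dual_act (row r M) a 0 s.

Hypothesis act_bimod : bimodule_action.

Lemma tensor_lactE a (x : 'cV[B]_d) (y : 'rV[B]_d) :
  tensor_lact a (x *m y) = act a x *m y.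
Proof.
apply/matrixP=> r s; rewrite !mxE big_ord1.
have -> : col s (x *m y) = y 0 s *: x.
  by apply/matrixP=> p q; rewrite !mxE big_ord1 mulrC (ord1 q).
by rewrite (actB act_bimod) mxE mulrC.
Qed.

Lemma tensor_ractE a (x : 'cV[B]_d) (y : 'rV[B]_d) :
  tensor_ract (x *m y) a = x *m dual_act y a.
Proof.
apply/matrixP=> r s; rewrite !mxE big_ord1.
have -> : (row r (x *m y))^T = x r 0 *: y^T.
  by apply/matrixP=> p q; rewrite !mxE big_ord1 (ord1 q).
by rewrite (actB act_bimod) !mxE.
Qed.

End CellTensors.

(* J is an affine cell ideal exactly when this type is inhabited.  Only the    *)
(* restriction of alpha to J is meaningful; its inverse is alphaV.  The form   *)
(* psi exists and is unique given the other components.                        *)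
Record cell_datum (k : idomainType) (A : algType k) (i : A -> A)
    (J : {pred A}) := CellDatum {
  cell_ideal : ideal_closed J;
  cell_stable : forall x, (i x \in J) = (x \in J);
  cell_rank : nat;
  cell_rank_gt0 : (0 < cell_rank)%N;
  cell_ring : comAlgType k;
  cell_ring_affine : finitely_generated cell_ring;
  cell_sigma : cell_ring -> cell_ring;
  cell_sigma_invol : k_involution cell_sigma;
  cell_act : A -> 'cV[cell_ring]_cell_rank -> 'cV[cell_ring]_cell_rank;
  cell_actP : bimodule_action cell_act;
  cell_alpha : A -> 'M[cell_ring]_cell_rank;
  cell_alphaV : 'M[cell_ring]_cell_rank -> A;
  cell_alphaV_in : forall M, cell_alphaV M \in J;
  cell_alphaK : forall x, x \in J -> cell_alphaV (cell_alpha x) = x;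
  cell_alphaVK : forall M, cell_alpha (cell_alphaV M) = M;
  cell_alphaD : forall x y, x \in J -> y \in J ->
    cell_alpha (x + y) = cell_alpha x + cell_alpha y;
  cell_alpha_lact : forall a x, x \in J ->
    cell_alpha (a * x) = tensor_lact cell_act a (cell_alpha x);
  cell_alpha_ract : forall a x, x \in J ->
    cell_alpha (x * a) = tensor_ract i cell_act (cell_alpha x) a;
  cell_alpha_invol : forall u b v,
    cell_alpha (i (cell_alphaV (pure_tensor u b v))) =
    pure_tensor v (cell_sigma b) u;
  cell_psi : 'cV[k]_cell_rank -> 'cV[k]_cell_rank -> cell_ring;
  cell_psi_linearl : forall v, linear (cell_psi^~ v);
  cell_psi_linearr : forall u, linear (cell_psi u);
  cell_psiP : forall u b v u' b' v',
    cell_alpha (cell_alphaV (pure_tensor u b v) *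
                cell_alphaV (pure_tensor u' b' v')) =
    pure_tensor u (b * cell_psi v u' * b') v' }.

Arguments cell_sigma {k A i J} c _.
Arguments cell_act {k A i J} c _ _.
Arguments cell_alpha {k A i J} c _.
Arguments cell_alphaV {k A i J} c _.
Arguments cell_psi {k A i J} c _ _.

Section CellModule.
Variables (k : idomainType) (A : algType k) (i : A -> A) (J : {pred A}).
Variable C : cell_datum i J.

Definition swich_mx : 'M[cell_ring C]_(cell_rank C) :=
  \matrix_(r, s) cell_psi C (delta_mx r 0) (delta_mx s 0).

Definition cell_module : Type := 'cV[cell_ring C]_(cell_rank C).
HB.instance Definition _ := GRing.Zmodule.on cell_module.

Let scaleA a b (x : cell_module) :
  cell_act C a (cell_act C b x) = cell_act C (a * b) x.
Proof. by rewrite (actM (cell_actP C)). Qed.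
Let scale1 : left_id 1 (cell_act C : A -> cell_module -> cell_module).
Proof. exact: act1 (cell_actP C). Qed.
Let scaleDr : right_distributive
  (cell_act C : A -> cell_module -> cell_module) +%R.
Proof. exact: actDr (cell_actP C). Qed.
Let scaleDl (x : cell_module) : {morph (cell_act C)^~ x : a b / a + b}.
Proof. by move=> a b; exact: actDl (cell_actP C) a b x. Qed.
HB.instance Definition _ := GRing.Zmodule_isLmodule.Build A cell_module
  scaleA scale1 scaleDr scaleDl.

End CellModule.

Definition partial_sum (V : zmodType) n (L : 'I_n -> {pred V}) (m : nat) :
    {pred V} :=
  [pred x | `[< exists y : 'I_n -> V,
    (forall l, y l \in L l) /\ x = \sum_(l < n | (l < m)%N) y l >]].

Section CellChain.
Variables (k : idomainType) (A : algType k) (i : A -> A).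

(* A = J'_1 (+) ... (+) J'_n as k-modules, numbered from 0, so that layer j is *)
(* J'_(j+1), and chain m is J_m.                                               *)
Record cell_chain := CellChain {
  chain_length : nat;
  layer : 'I_chain_length -> {pred A};
  layer_submod : forall j, submod_closed (layer j);
  layer_direct : forall x : A, exists! y : {ffun 'I_chain_length -> A},
    (forall j, y j \in layer j) /\ x = \sum_j y j;
  layer_stable : forall j x, (i x \in layer j) = (x \in layer j);
  chain := partial_sum layer;
  chain_ideal : forall m, (m <= chain_length)%N -> ideal_closed (chain m);
  chain_strict : forall j : 'I_chain_length,
    exists2 x, x \in chain j.+1 & x \notin chain j }.

Lemma chain_proper (C : cell_chain) (j : 'I_(chain_length C)) :
  1 \notin chain C j.
Proof.
have [x _ xj] := chain_strict j.
have [_ _ idr] := chain_ideal (ltnW (ltn_ord j)).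
by apply: contra xj => /(idr x); rewrite mul1r.
Qed.

Definition chain_pideal (C : cell_chain) (j : 'I_(chain_length C)) :=
  TwosidedIdeal (chain_ideal (ltnW (ltn_ord j))) (chain_proper j).

(* J_(j+1)/J_j as an ideal of A/J_j *)
Definition subquotient (C : cell_chain) (j : 'I_(chain_length C)) :
    {pred alg_quot (chain_pideal j)} :=
  quot_ideal (chain_pideal j) (chain C j.+1).

Arguments subquotient [C] j _.

Record affine_cellular := AffineCellular {
  cellular_chain :> cell_chain;
  cellular_datum : forall j : 'I_(chain_length cellular_chain),
    cell_datum (quot_invol (chain_pideal j) i) (subquotient j) }.

Definition Delta (C : affine_cellular) (j : 'I_(chain_length C)) : lmodType A :=
  restrict_scalars (quot_proj (chain_pideal j)) (cell_module (cellular_datum j)).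

End CellChain.

Arguments subquotient [k A i C] j _.

(* Main.v *)
(* An element of J_i/J_(i-1) with matrix M acts on Delta_i = B^d by M psi, and *)
(* J_i kills Delta_j for j > i.                                                *)
(* (1) If J_i/J_(i-1) is idempotent then 1 is a sum of products P psi Q; hence *)
(* J_i Delta_i = Delta_i, which gives (a), and the endomorphisms of Delta_i    *)
(* are exactly the multiplications by elements of B, which gives (b).          *)
(* (2) The image of a homomorphism Delta_j -> Delta_i lies in ker psi, which   *)
(* is 0 if det psi is regular.  If det psi is a zero-divisor, McCoy's theorem  *)
(* gives x <> 0 in ker psi; for the first j with J_j x <> 0 the map a |-> a x  *)
(* is defined on J_j/J_(j-1), a direct sum of copies of Delta_j.               *)

Require Import Defs.
From HB Require Import structures.
From mathcomp Require Import all_boot all_order all_algebra.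
From mathcomp Require Import boolp.
Set Implicit Arguments.
Unset Strict Implicit.
Unset Printing Implicit Defensive.
Import GRing.Theory.
Local Open Scope ring_scope.

(** Everything rests on [cell_act_alphaV]: the ideal of a cell datum acts on the cell module by x
    |-> M psi x, so ker psi is exactly what that ideal annihilates ([chain_scale0_swich]).
    Idempotency writes 1 as a sum of P psi Q ([idempotent_swich]); hence the ideal times the cell
    module is everything, and endomorphisms are scalars of B ([idempotent_cell_endo]). Maps from a
    later layer land in ker psi. Conversely, a zero-divisor determinant yields a nonzero kernel
    vector ([zero_divisor_det_ker]), and from it a nonzero map out of some later layer
    ([ex_hom_Delta]). *)

(* Either y kills the maximal minors of M without its first column, or Laplace *)
(* expansion shows that y times a vector of signed minors lies in the kernel.  *)
Lemma mccoy_minors (R : comNzRingType) m n (M : 'M[R]_(m, n)) (y : R) :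
  y != 0 -> (forall g : 'I_n -> 'I_m, y * \det (rowsub g M) = 0) ->
  exists2 x : 'cV[R]_n, x != 0 & M *m x = 0.
Proof.
move=> y0; elim: n M => [|n IHn] M minor0.
  have h : 'I_0 -> 'I_m by case.
  by have := minor0 h; rewrite det_mx00 mulr1 => /eqP; rewrite (negPf y0).
have [minor0'|] := pselect (forall g : 'I_n -> 'I_m,
    y * \det (rowsub g (col' ord0 M)) = 0).
  have [x x0 Mx0] := IHn _ minor0'.
  exists (\col_j oapp (fun l => x l 0) 0 (unlift ord0 j)).
    apply: contra x0 => /eqP/colP x0; apply/eqP/colP=> j.
    by have := x0 (lift ord0 j); rewrite !mxE liftK.
  apply/colP=> r; have /colP/(_ r) := Mx0; rewrite !mxE => Mx0r.
  rewrite -[RHS]Mx0r big_ord_recl mxE unlift_none /= mulr0 add0r.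
  by apply: eq_bigr => j _; rewrite !mxE liftK.
move=> /existsNP[g /eqP g0].
(* [N r] puts row r of M on top of the rows chosen by g. Its cofactors along the top row do not
   depend on r, so one vector of signed minors serves all rows. *)
pose N r : 'M_n.+1 := rowsub (fun l => oapp g r (unlift ord0 l)) M.
have N_row' r j : row' ord0 (col' j (N r)) = rowsub g (col' j M).
  by apply/matrixP=> p q; rewrite !mxE liftK.
exists (\col_j (y * ((-1) ^+ j * \det (rowsub g (col' j M))))).
  apply: contra g0 => /eqP/colP/(_ ord0).
  by rewrite !mxE expr0 mul1r => ->.
apply/colP=> r; rewrite !mxE.
have := minor0 (fun l => oapp g r (unlift ord0 l)).
rewrite -/(N r) (expand_det_row _ ord0) mulr_sumr => Nr0.
rewrite -[RHS]Nr0; apply: eq_bigr => j _; rewrite !mxE unlift_none /= /cofactor N_row' add0n.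
by rewrite mulrCA.
Qed.

Lemma zero_divisor_det_ker (R : comNzRingType) n (M : 'M[R]_n) :
  zero_divisor (\det M) -> exists2 x : 'cV[R]_n, x != 0 & M *m x = 0.
Proof.
case=> y y0 My0; apply: (mccoy_minors y0) => g.
have -> : rowsub g M = rowsub g 1%:M *m M by rewrite mul_rowsub_mx mul1mx.
by rewrite det_mulmx mulrCA [y * _]mulrC My0 mulr0.
Qed.

(** * The action of one cell ideal on its cell module *)

Section CellDatum.
Variables (k : idomainType) (A : algType k) (i : A -> A) (J : {pred A}).
Variable C : cell_datum i J.
Local Notation d := (cell_rank C).
Local Notation B := (cell_ring C).
Local Notation act := (cell_act C).
Local Notation alpha := (cell_alpha C).
Local Notation alphaV := (cell_alphaV C).

Lemma cell_alphaVD M N : alphaV (M + N) = alphaV M + alphaV N.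
Proof.
have [[J0 JB] _ _] := cell_ideal C.
have JM := cell_alphaV_in (c := C) M; have JN := cell_alphaV_in (c := C) N.
have JD : alphaV M + alphaV N \in J.
  by rewrite -[alphaV N]opprK -[- alphaV N]add0r; exact/JB/JB.
by rewrite -[RHS](cell_alphaK C JD) (cell_alphaD C JM JN) !cell_alphaVK.
Qed.

Lemma cell_alphaV0 : alphaV 0 = 0.
Proof. by apply: (addIr (alphaV 0)); rewrite -cell_alphaVD !add0r. Qed.

Lemma cell_alphaV_sum I (r : seq I) (F : I -> 'M[B]_d) :
  alphaV (\sum_(j <- r) F j) = \sum_(j <- r) alphaV (F j).
Proof. exact: (big_morph _ cell_alphaVD cell_alphaV0). Qed.

Lemma cell_alphaV_lact a M : alphaV (tensor_lact act a M) = a * alphaV M.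
Proof.
have [_ Jl _] := cell_ideal C.
rewrite -[RHS](cell_alphaK C (Jl _ _ (cell_alphaV_in (c := C) M))).
by rewrite (cell_alpha_lact C _ (cell_alphaV_in (c := C) M)) cell_alphaVK.
Qed.

Lemma cell_act0l x : act 0 x = 0.
Proof.
by apply: (addIr (act 0 x)); rewrite -(actDl (cell_actP C)) !add0r.
Qed.

Lemma cell_act0r a : act a 0 = 0.
Proof.
by apply: (addIr (act a 0)); rewrite -(actDr (cell_actP C)) !add0r.
Qed.

Lemma cell_act_suml I (r : seq I) (F : I -> A) x :
  act (\sum_(j <- r) F j) x = \sum_(j <- r) act (F j) x.
Proof.
exact: (big_morph (act^~ x) (fun a b => actDl (cell_actP C) a b x) (cell_act0l x)).
Qed.

Lemma cell_act_sumr I (r : seq I) (F : I -> 'cV[B]_d) a :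
  act a (\sum_(j <- r) F j) = \sum_(j <- r) act a (F j).
Proof.
exact: (big_morph (act a) (actDr (cell_actP C) a) (cell_act0r a)).
Qed.

Lemma col_tensor_lact a M s : col s (tensor_lact act a M) = act a (col s M).
Proof. by apply/colP=> r; rewrite !mxE. Qed.

Lemma pure_tensor_delta r (b : B) (s : 'I_d) :
  pure_tensor (delta_mx r 0) b (delta_mx s 0) = b *: delta_mx r s :> 'M_d.
Proof.
apply/matrixP=> p q; rewrite !mxE !andbT.
by case: (p == r); case: (q == s); rewrite ?mulr1 ?mulr0 ?scale1r ?scale0r.
Qed.

(** [alpha] turns left multiplication into the action on columns, so any one column of the product
    rule for [psi] gives the action on the module. *)
Lemma cell_act_delta (b b' : B) r s t :
  act (alphaV (b *: delta_mx r s)) (b' *: delta_mx t 0) =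
  (b * swich_mx C s t * b') *: delta_mx r 0.
Proof.
pose s0 := Ordinal (cell_rank_gt0 C).
have colE (c : B) p : col s0 (c *: delta_mx p s0) = c *: delta_mx p 0.
  by apply/colP=> q; rewrite !mxE !eqxx.
have := cell_psiP (c := C) (delta_mx r 0) b (delta_mx s 0) (delta_mx t 0) b' (delta_mx s0 0).
rewrite !pure_tensor_delta (cell_alpha_lact C _ (cell_alphaV_in (c := C) _)) cell_alphaVK.
by move/(congr1 (col s0)); rewrite col_tensor_lact !colE mxE.
Qed.

Lemma cell_act_alphaV M x : act (alphaV M) x = M *m swich_mx C *m x.
Proof.
have xE : x = \sum_t x t 0 *: delta_mx t 0.
  by rewrite {1}[x]matrix_sum_delta; apply: eq_bigr => t _; rewrite big_ord1.
rewrite {1}[M]matrix_sum_delta cell_alphaV_sum cell_act_suml.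
rewrite [RHS]matrix_sum_delta; apply: eq_bigr => r _; rewrite big_ord1.
rewrite cell_alphaV_sum cell_act_suml -mulmxA mxE scaler_suml.
apply: eq_bigr => s _; rewrite mxE mulr_sumr scaler_suml {1}xE cell_act_sumr.
by apply: eq_bigr => t _; rewrite cell_act_delta mulrA.
Qed.

Lemma cell_act_swich_ker a x : a \in J -> swich_mx C *m x = 0 -> act a x = 0.
Proof.
by move=> Ja x0; rewrite -(cell_alphaK C Ja) cell_act_alphaV -mulmxA x0 mulmx0.
Qed.

Lemma swich_ker_cell_act x : (forall a, a \in J -> act a x = 0) ->
  swich_mx C *m x = 0.
Proof.
by move/(_ _ (cell_alphaV_in (c := C) 1%:M)); rewrite cell_act_alphaV mul1mx.
Qed.

Lemma cell_alphaV_mul P Q :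
  alphaV P * alphaV Q = alphaV (P *m swich_mx C *m Q).
Proof.
rewrite -cell_alphaV_lact; congr alphaV; apply/matrixP=> r s.
by rewrite mxE cell_act_alphaV !colE !mulmxA -colE mxE.
Qed.

Lemma idempotent_swich : idempotent_ideal J ->
  exists r : seq ('M[B]_d * 'M[B]_d),
    1%:M = \sum_(p <- r) p.1 *m swich_mx C *m p.2.
Proof.
move=> /(_ (alphaV 1%:M)); rewrite cell_alphaV_in => /asboolP[r [Jr r1]].
(* Idempotency splits the preimage of the identity matrix into products of elements of J; [alpha]
   carries each product to P psi Q. *)
exists [seq (alpha p.1, alpha p.2) | p <- r].
rewrite -[LHS](cell_alphaVK (c := C)) r1 big_map.
under eq_big_seq => p /Jr[Jp1 Jp2] do
  rewrite -(cell_alphaK C Jp1) -(cell_alphaK C Jp2) cell_alphaV_mul.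
by rewrite -cell_alphaV_sum cell_alphaVK.
Qed.

Lemma idempotent_cell_module : idempotent_ideal J ->
  exists r : seq ('M[B]_d * 'M[B]_d),
    forall x, x = \sum_(p <- r) act (alphaV p.1) (p.2 *m x).
Proof.
move=> /idempotent_swich[r r1]; exists r => x.
rewrite -[LHS]mul1mx r1 mulmx_suml.
by apply: eq_bigr => p _; rewrite cell_act_alphaV mulmxA.
Qed.

(* Since 1 is a sum of products P psi Q, commuting with the action M psi of J  *)
(* forces commuting with all of M_d(B).                                        *)
Lemma idempotent_cell_endo (f : {additive 'cV[B]_d -> 'cV[B]_d}) :
  idempotent_ideal J ->
  (forall M x, f (act (alphaV M) x) = act (alphaV M) (f x)) ->
  exists b : B, forall x, f x = b *: x.
Proof.
move=> /idempotent_swich[r r1] fact.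
have fM N x : f (N *m x) = N *m f x.
  have E y : N *m y = \sum_(p <- r) act (alphaV (N *m p.1)) (p.2 *m y).
    rewrite -[N in LHS]mulmx1 r1 mulmx_sumr mulmx_suml.
    by apply: eq_bigr => p _; rewrite cell_act_alphaV !mulmxA.
  rewrite E raddf_sum.
  under eq_bigr do rewrite fact cell_act_alphaV.
  (* The vectors [f (p.2 *m x)] stay unexpanded: f is only known to commute with the outer
     action. *)
  have -> : f x = \sum_(p <- r) act (alphaV p.1) (f (p.2 *m x)).
    under eq_bigr do rewrite -fact cell_act_alphaV.
    rewrite -raddf_sum; congr (f _); rewrite -[LHS]mul1mx r1 mulmx_suml.
    by apply: eq_bigr => p _; rewrite mulmxA.
  rewrite mulmx_sumr; apply: eq_bigr => p _.
  by rewrite cell_act_alphaV !mulmxA.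
(* With e the basis vector at s, x = (x e^T) e, so f x = x (e^T f e), and the scalar is the s-th
   entry of f e. *)
pose s := Ordinal (cell_rank_gt0 C).
exists (f (delta_mx s 0) s 0) => x.
have xE : x = x *m delta_mx 0 s *m delta_mx s 0.
  rewrite -mulmxA mul_delta_mx.
  by apply/colP=> p; rewrite !mxE big_ord1 !mxE !eqxx mulr1.
rewrite {1}xE fM -mulmxA; apply/colP=> p.
rewrite mxE big_ord1 [RHS]mxE mulrC; congr (_ * _).
by rewrite -rowE mxE.
Qed.

End CellDatum.

(** * Cell modules along the chain *)

Section Chain.
Variables (k : idomainType) (A : algType k) (iota : A -> A).
Variable C : affine_cellular iota.
Local Notation n := (chain_length C).
Local Notation datum := (cellular_datum (a := C)).
Local Notation proj j := (quot_proj (chain_pideal (C := C) j)).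

Lemma chain_mono m m' a : (m <= m')%N -> a \in chain C m -> a \in chain C m'.
Proof.
move=> le_mm' /asboolP[y [Ly ->]]; apply/asboolP.
exists (fun l : 'I_n => if (l < m)%N then y l else 0); split=> [l|].
  by case: ifP => // _; case: (layer_submod (c := C) l).
rewrite -big_mkcondr; apply: eq_bigl => l.
by rewrite andb_idl // => /leq_trans; apply.
Qed.

Lemma chain_full a : a \in chain C n.
Proof.
have [y [[Ly ->] _]] := layer_direct C a; apply/asboolP.
by exists y; split=> //; apply: eq_bigl => l; rewrite ltn_ord.
Qed.

Lemma Delta_scaleE (j : 'I_n) a (x : Delta j) :
  a *: x = cell_act (datum j) (proj j a) x.
Proof. by []. Qed.

(** [Delta j] is pulled back from the quotient by [chain C j]. The layer's own ideal is
    [chain C j.+1], so every earlier layer's ideal acts by zero. *)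
Lemma Delta_chain_scale0 (j : 'I_n) a (x : Delta j) : a \in chain C j -> a *: x = 0.
Proof.
move=> aj; rewrite Delta_scaleE (_ : proj j a = 0) ?cell_act0l //.
by rewrite -(raddf0 (proj j)); apply/quot_projP; rewrite subr0.
Qed.

Lemma chain_alphaV (j : 'I_n) M :
  exists2 a, a \in chain C j.+1 & proj j a = cell_alphaV (datum j) M.
Proof.
by have /asboolP[a aj ->] := cell_alphaV_in (c := datum j) M; exists a.
Qed.

Lemma chain_scale0_swich (j : 'I_n) (x : Delta j) :
  (forall a, a \in chain C j.+1 -> a *: x = 0) <->
  swich_mx (datum j) *m (x : 'cV_(cell_rank (datum j))) = 0.
Proof.
split=> [x0|x0 a aj].
  apply: swich_ker_cell_act => q /asboolP[a aj ->].
  by rewrite -Delta_scaleE x0.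
by rewrite Delta_scaleE cell_act_swich_ker //; apply/asboolP; exists a.
Qed.

Lemma ex_hom_Delta (i : 'I_n) (x : Delta i) : x != 0 ->
  swich_mx (datum i) *m (x : 'cV_(cell_rank (datum i))) = 0 ->
  exists2 j : 'I_n, (i < j)%N &
    exists (f : {linear Delta j -> Delta i}) (z : Delta j), f z != 0.
Proof.
move=> x0 /chain_scale0_swich xJ.
(* The least m for which [chain C m] moves x exists, since 1 lies in the last term, and exceeds i+1.
   With m = j+1, [chain C j] kills x while [chain C j.+1] does not. *)
pose P m := `[< exists2 a, a \in chain C m & a *: x != 0 >].
have Pn : P n by apply/asboolP; exists 1; rewrite ?chain_full ?scale1r.
case: (ex_minnP (ex_intro P n Pn)) => m /asboolP[a am ax] m_min.
have lt_im : (i.+1 < m)%N.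
  rewrite ltnNge; apply/negP=> le_mi; case/eqP: ax.
  exact/xJ/(chain_mono le_mi).
case: m => // m' in am m_min lt_im *.
have lt_m'n : (m' < n)%N := m_min n Pn.
pose j : 'I_n := Ordinal lt_m'n; exists j => //.
have kill b : b \in chain C j -> b *: x = 0.
  move=> bj; apply: contrapT => /eqP bx.
  have /m_min : P m' by apply/asboolP; exists b.
  by rewrite ltnn.
have projE b c : proj j b = proj j c -> b *: x = c *: x.
  by move/quot_projP/kill/eqP; rewrite scalerBl subr_eq0 => /eqP.
(* Place z in column s, lift that element of the subquotient to A and apply it to x; by [projE] the
   choice of lift is immaterial. *)
pose g s (z : Delta j) : Delta i := quot_repr
  (cell_alphaV (datum j) ((z : 'cV_(cell_rank (datum j))) *m delta_mx 0 s)) *: x.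
have g_linear s : linear (g s).
  move=> c y z; rewrite /g scalerA -scalerDl; apply: projE.
  rewrite quot_projD (rmorphM (proj j)) /= !quot_proj_repr.
  rewrite -cell_alphaV_lact -cell_alphaVD.
  by rewrite (tensor_lactE (cell_actP _)) -mulmxDl.
have [g0|] := pselect (forall s z, g s z = 0); last first.
  move=> /existsNP[s /existsNP[z /eqP gz]].
  pose f : {linear Delta j -> Delta i} := HB.pack (g s)
    (GRing.isLinear.Build A (Delta j) (Delta i) _ (g s) (g_linear s)).
  by exists f, z.
(* Modulo [chain C j], a is the sum of its columns, so if every [g s] vanished, then a would kill
   x. *)
case/eqP: ax; pose M := cell_alpha (datum j) (proj j a).
have aM : proj j a = cell_alphaV (datum j) M.
  by rewrite cell_alphaK //; apply/asboolP; exists a.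
have ME : M = \sum_s col s M *m delta_mx 0 s.
  rewrite {1}[M]matrix_sum_delta exchange_big; apply: eq_bigr => s _.
  apply/matrixP=> p q; rewrite summxE !mxE big_ord1 !mxE /= (bigD1 p) //=.
  rewrite big1 ?addr0 => [|r /negPf rp]; first by rewrite !mxE eqxx.
  by rewrite !mxE eq_sym rp mulr0.
transitivity (\sum_s g s (col s M)); last by apply: big1 => s _; exact: g0.
rewrite -scaler_suml; apply: projE; rewrite raddf_sum aM {1}ME cell_alphaV_sum.
by apply: eq_bigr => s _; rewrite /= quot_proj_repr.
Qed.

End Chain.

Theorem theorem5 (k : idomainType) (k_noetherian : noetherian k)
    (A : algType k) (iota : A -> A) (iota_invol : k_involution iota)
    (C : affine_cellular iota) (i : 'I_(chain_length C)) :
  (idempotent_ideal (subquotient i) ->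
     (forall j : 'I_(chain_length C), (i < j)%N ->
        forall f : {linear Delta i -> Delta j}, forall x, f x = 0) /\
     ((forall f : {linear Delta i -> Delta i},
         (exists x, f x != 0) -> injective f) <->
      GRing.integral_domain_axiom (cell_ring (cellular_datum i)))) /\
  ((forall j : 'I_(chain_length C), (i < j)%N ->
      forall f : {linear Delta j -> Delta i}, forall x, f x = 0) <->
   ~ zero_divisor (\det (swich_mx (cellular_datum i)))).
Proof.
pose D := cellular_datum i.
split; [move=> idem; split | split].
- move=> j lt_ij f x; have [r rE] := idempotent_cell_module D idem.
  (* x is a sum of multiples by elements of [chain C i.+1], which lies in [chain C j] and so kills
     [Delta j]. *)
  rewrite [x](rE x) (raddf_sum f); apply: big1 => p _.
  have [a ai <-] := chain_alphaV (j := i) p.1.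
  rewrite -Delta_scaleE /= linearZ_LR Delta_chain_scale0 //.
  exact: chain_mono ai.
- split=> [inj b c bc0|dom f [x fx0]].
  + have [//|b0] := eqVneq b 0; apply/eqP.
    (* Multiplication by b is a nonzero endomorphism, hence injective; it kills c times a basis
       vector, so c = 0. *)
    pose g (y : Delta i) : Delta i := b *: (y : 'cV_(cell_rank D)).
    have g_linear : linear g.
      move=> a y z; rewrite /g Delta_scaleE (scalerDr b (_ : 'cV_(cell_rank D))).
      by rewrite Delta_scaleE (actB (cell_actP D)).
    pose f : {linear Delta i -> Delta i} := HB.pack g
      (GRing.isLinear.Build A (Delta i) (Delta i) _ g g_linear).
    pose s := Ordinal (cell_rank_gt0 D).
    have f_inj : injective f.
      apply: inj; exists (delta_mx s 0 : 'cV_(cell_rank D)).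
      apply: contra b0 => /eqP/colP/(_ s).
      by rewrite !mxE !eqxx mulr1 => ->.
    have : (c *: delta_mx s 0 : 'cV_(cell_rank D)) = 0.
      apply: f_inj; rewrite raddf0; apply/colP=> p.
      by rewrite !mxE mulrA bc0 mul0r.
    by move=> /colP/(_ s); rewrite !mxE !eqxx mulr1.
  + have [b fE] : exists b, forall y : 'cV_(cell_rank D), f y = b *: y.
      apply: (idempotent_cell_endo (f := f)) => // M y.
      have [a _ <-] := chain_alphaV (j := i) M.
      exact: (linearZ_LR f).
    have b0 : b != 0.
      by apply: contra fx0 => /eqP b0; rewrite fE b0 scale0r.
    move=> y z; rewrite !fE => /colP yz; apply/colP=> p.
    have := yz p; rewrite !mxE => /eqP; rewrite -subr_eq0 -mulrBr => /eqP/dom.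
    by rewrite (negPf b0) subr_eq0 => /eqP.
- move=> hom0 /zero_divisor_det_ker[x x0 psix0].
  have [j lt_ij [f [z /eqP[]]]] := ex_hom_Delta (i := i) x0 psix0.
  exact: hom0.
- move=> ndet j lt_ij f x; apply: contrapT => /eqP fx0; apply: ndet.
  have /chain_scale0_swich psifx : forall a, a \in chain C i.+1 -> a *: f x = 0.
    move=> a ai; rewrite -linearZ_LR Delta_chain_scale0 ?raddf0 //.
    exact: chain_mono ai.
  (* The adjugate of psi turns psi (f x) = 0 into det psi times f x = 0; a nonzero entry of f x is
     then the witness. *)
  have detfx : \det (swich_mx D) *: (f x : 'cV_(cell_rank D)) = 0.
    by rewrite -mul_scalar_mx -mul_adj_mx -mulmxA psifx mulmx0.
  have [p fxp] : exists p, (f x : 'cV_(cell_rank D)) p 0 != 0.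
    apply: contrapT => /forallNP fxp; case/eqP: fx0; apply/colP=> p.
    by rewrite mxE; apply/eqP/negPn/negP/fxp.
  by exists ((f x : 'cV_(cell_rank D)) p 0) => //; have /colP/(_ p) := detfx; rewrite !mxE.
Qed.
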